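(* For all $a=(a_k)_{k\in\mathbb{N}}\in\ell^\infty$, $$r(T_a)\ \le\ M(|a|)\ \le\ \|a\|_w\ \le\ \|a\|_\infty .$$
   Context: $\mathbb{N}=\{1,2,3,\dots\}$. $\ell^2$ is the complex Hilbert space of square-summable unilateral sequences $(x_k)_{k\in\mathbb{N}}$, and $\ell^\infty$ the complex Banach space of bounded complex sequences with the uniform norm $\|\cdot\|_\infty$. For $a\in\ell^\infty$, the (unilateral) weighted forward shift $T_a:\ell^2\to\ell^2$ is the bounded operator $T_a(x_1,x_2,\dots)=(0,a_1x_1,a_2x_2,\dots)$, and $r(T_a)$ denotes its spectral radius. The numerical radius of a bounded operator $T$ on a complex Hilbert space $H$ is $w(T)=\sup\{|\langle Tx,x\rangle| : x\in H,\ \|x\|=1\}$. Set $\|a\|_w:=w(T_a)$, which is a norm on $\ell^\infty$. $|a|=(|a_k|)_{k\in\mathbb N}$, and $$M(|a|):=\lim_{n\to\infty}\sup_{j\in\mathbb{N}}\frac1n\sum_{k=1}^{n}|a_{k+j-1}|$$ (the limit exists for every bounded sequence). *)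

(* Defs.v *)
From HB Require Import structures.
From mathcomp Require Import all_boot all_order all_algebra.
From mathcomp Require Import sesquilinear.
From mathcomp Require Import all_classical all_reals all_analysis.
From mathcomp Require Import complex.
From mathcomp Require Import ring lra.

Set Implicit Arguments.
Unset Strict Implicit.
Unset Printing Implicit Defensive.
Import Order.TTheory GRing.Theory Num.Theory.
Import numFieldNormedType.Exports.
Import ComplexField.Normc.
Local Open Scope classical_set_scope.
Local Open Scope ring_scope.
Local Open Scope complex_scope.

(* The field of complex numbers is R[i] for R : realType; normc : R[i] -> R is
   the modulus as an element of R.  Sequences indexed by {1, 2, 3, ...} are
   functions on nat shifted by one: a k is the term written a_(k+1). *)

Section Operators.
Context {R : realType} {H : lmodType R[i]} (dot : {dot H for Num.conj}).

Definition hnorm (x : H) : R := Num.sqrt (complex.Re (dot x x)).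

Definition bounded_operator (T : H -> H) : Prop :=
  exists M : R, forall x, hnorm (T x) <= M * hnorm x.

Definition spectrum (T : H -> H) : set R[i] :=
  [set z | ~ exists S : {linear H -> H},
     [/\ bounded_operator S,
         forall x, S (T x - z *: x) = x &
         forall x, T (S x) - z *: S x = x]].

(* The suprema are taken in R; for a bounded linear T on a nonzero Hilbert
   space both sets are nonempty and bounded, so that they are the usual ones. *)
Definition spectral_radius (T : H -> H) : R :=
  sup [set normc z | z in spectrum T].

Definition numerical_radius (T : H -> H) : R :=
  sup [set normc (dot (T x) x) | x in [set x | hnorm x = 1]].

End Operators.

Section Ell2.
Context {R : realType}.
Implicit Types x u : nat -> R[i].

Definition square_summable x : Prop :=
  cvgn (series (fun k => normc (x k) ^+ 2)).

Definition ell2_pred : {pred nat -> R[i]} := fun x => `[< square_summable x >].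

(* R[i] carries no topology in the library, hence the componentwise limit. *)
Definition csum u : R[i] :=
  limn (series (fun k => complex.Re (u k))) +i*
  limn (series (fun k => complex.Im (u k))).

Lemma sqr_normcE (z : R[i]) :
  normc z ^+ 2 = complex.Re z ^+ 2 + complex.Im z ^+ 2.
Proof. by case: z => p q /=; rewrite sqr_sqrtr// addr_ge0// sqr_ge0. Qed.

Lemma normc_ge0 (z : R[i]) : 0 <= normc z.
Proof. by case: z => p q; exact: sqrtr_ge0. Qed.

Lemma ell2_submod_closed : submod_closed ell2_pred.
Proof.
split.
  apply/asboolP; rewrite /square_summable.
  have -> : (fun k => normc ((0 : nat -> R[i]) k) ^+ 2) = (fun=> 0).
    by apply/funext => k; rewrite (_ : _ k = 0 :> R[i])// normc0 expr0n.
  rewrite (_ : series _ = cst 0); last first.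
    by apply/funext => n; rewrite /series/= big1.
  exact: is_cvg_cst.
move=> c x y /asboolP hx /asboolP hy; apply/asboolP; rewrite /square_summable.
apply: (@series_le_cvg _ _ (fun k => 2 * normc c ^+ 2 * normc (x k) ^+ 2 +
                                     2 * normc (y k) ^+ 2)).
- by move=> n; rewrite sqr_ge0.
- move=> n; apply: addr_ge0; do ?apply: mulr_ge0; rewrite ?ler0n ?sqr_ge0//; exact: normc_ge0.
- move=> n; have -> : (c *: x + y) n = c * x n + y n by [].
  rewrite !sqr_normcE; case: c (x n) (y n) => [c1 c2] [x1 x2] [y1 y2] /=.
  rewrite -subr_ge0.
  rewrite [X in 0 <= X](_ : _ = (c1 * x1 - c2 * x2 - y1) ^+ 2 +
                                (c1 * x2 + c2 * x1 - y2) ^+ 2); last by ring.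
  by rewrite addr_ge0// sqr_ge0.
- apply: is_cvg_seriesD; last exact: is_cvg_seriesZ hy.
  exact: is_cvg_seriesZ hx.
Qed.

HB.instance Definition _ :=
  GRing.isSubmodClosed.Build _ _ ell2_pred ell2_submod_closed.

End Ell2.

Record ell2 (R : realType) := Ell2 {
  ell2_val :> nat -> R[i];
  ell2_valP : ell2_val \in ell2_pred }.

HB.instance Definition _ (R : realType) := [isSub for @ell2_val R].
HB.instance Definition _ (R : realType) := [Choice of ell2 R by <:].
HB.instance Definition _ (R : realType) :=
  [SubChoice_isSubLmodule of ell2 R by <:].

Definition ell2_dot {R : realType} (x y : ell2 R) : R[i] :=
  csum (fun k => x k * (y k)^*).

Section Ell2Dot.
Context {R : realType}.
Implicit Types x y z : ell2 R.

Lemma ell2P x : cvgn (series (fun k => normc (x k) ^+ 2)).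
Proof. by have /asboolP := ell2_valP x. Qed.

Lemma ell2D x y k : (x + y) k = x k + y k. Proof. by []. Qed.

Lemma ell2Z (c : R[i]) x k : (c *: x) k = c * x k. Proof. by []. Qed.

Lemma ell2_abs_cvg x y (f : R[i] -> R) :
  (forall p q : R[i], `|f (p * q^*)| <= normc p ^+ 2 + normc q ^+ 2) ->
  cvgn (series (fun k => f (x k * (y k)^*))).
Proof.
move=> hf; apply: normed_cvg.
apply: (@series_le_cvg _ _ (fun k => normc (x k) ^+ 2 + normc (y k) ^+ 2)).
- by move=> n; exact: normr_ge0.
- by move=> n; apply: addr_ge0; rewrite sqr_ge0.
- by move=> n; exact: hf.
- by apply: is_cvg_seriesD; exact: ell2P.
Qed.

Lemma ell2_Re_cvg x y :
  cvgn (series (fun k => complex.Re (x k * (y k)^*))).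
Proof.
apply: ell2_abs_cvg => -[p q] [r s]; rewrite !sqr_normcE/=.
have := (sqr_ge0 (p + r), sqr_ge0 (p - r), sqr_ge0 (q + s), sqr_ge0 (q - s)).
have := (sqr_ge0 p, sqr_ge0 q, sqr_ge0 r, sqr_ge0 s).
rewrite !sqrrD !sqrrN => -[[[? ?] ?] ?] [[[? ?] ?] ?].
by rewrite ler_norml; apply/andP; split; lra.
Qed.

Lemma ell2_Im_cvg x y :
  cvgn (series (fun k => complex.Im (x k * (y k)^*))).
Proof.
apply: ell2_abs_cvg => -[p q] [r s]; rewrite !sqr_normcE/=.
have := (sqr_ge0 (p + s), sqr_ge0 (p - s), sqr_ge0 (q + r), sqr_ge0 (q - r)).
have := (sqr_ge0 p, sqr_ge0 q, sqr_ge0 r, sqr_ge0 s).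
rewrite !sqrrD !sqrrN => -[[[? ?] ?] ?] [[[? ?] ?] ?].
by rewrite ler_norml; apply/andP; split; lra.
Qed.

Lemma lim_series_comb (f g h : nat -> R) (p q : R) :
  cvgn (series f) -> cvgn (series g) -> cvgn (series h) ->
  limn (series ((p *: f + q *: g) + h)) =
  p * limn (series f) + q * limn (series g) + limn (series h).
Proof.
move=> hf hg hh.
have hpf : cvgn (series (p *: f)) by exact: is_cvg_seriesZ.
have hqg : cvgn (series (q *: g)) by exact: is_cvg_seriesZ.
have hfg : cvgn (series (p *: f + q *: g)) by exact: is_cvg_seriesD.
by rewrite lim_seriesD// lim_seriesD// !lim_seriesZ.
Qed.

Lemma ell2_dot_linearl y c x z :
  ell2_dot (c *: x + z) y = c * ell2_dot x y + ell2_dot z y.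
Proof.
case: c => c1 c2; rewrite /ell2_dot /csum.
have hR := ell2_Re_cvg; have hI := ell2_Im_cvg.
rewrite (_ : (fun k => complex.Re _) =
   (c1 *: (fun k => complex.Re (x k * (y k)^*)) +
    (- c2) *: (fun k => complex.Im (x k * (y k)^*))) +
    (fun k => complex.Re (z k * (y k)^*))); last first.
  apply/funext => k; rewrite ell2D ell2Z.
  rewrite !fctE /= /GRing.scale /=.
  by case: (x k) (y k) (z k) => [? ?] [? ?] [? ?] /=; ring.
rewrite (_ : (fun k => complex.Im ((c1 +i* c2 *: x + z) k * (y k)^*)) =
   (c1 *: (fun k => complex.Im (x k * (y k)^*)) +
    c2 *: (fun k => complex.Re (x k * (y k)^*))) +
    (fun k => complex.Im (z k * (y k)^*))); last first.
  apply/funext => k; rewrite ell2D ell2Z.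
  rewrite !fctE /= /GRing.scale /=.
  by case: (x k) (y k) (z k) => [? ?] [? ?] [? ?] /=; ring.
rewrite !lim_series_comb//.
by congr (_ +i* _) => /=; ring.
Qed.

Lemma ell2_dotC x y : ell2_dot x y = Num.conj (ell2_dot y x).
Proof.
rewrite /ell2_dot /csum.
rewrite (_ : (fun k => complex.Re (y k * _)) =
             (fun k => complex.Re (x k * (y k)^*))); last first.
  by apply/funext => k; case: (x k) (y k) => [? ?] [? ?] /=; ring.
rewrite (_ : (fun k => complex.Im (y k * _)) =
             - (fun k => complex.Im (x k * (y k)^*))); last first.
  by apply/funext => k; rewrite fctE; case: (x k) (y k) => [? ?] [? ?] /=; ring.
rewrite seriesN limN; last exact: ell2_Im_cvg.
by rewrite -[RHS]/(_ +i* - - _) opprK.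
Qed.

Lemma ell2_dot_herm x y :
  ell2_dot x y = (-1) ^+ false * Num.conj (ell2_dot y x).
Proof. by rewrite mul1r ell2_dotC. Qed.

Lemma ell2_dot_bilinear :
  bilinear_for *%R (Num.conj \; *%R) (@ell2_dot R).
Proof.
split=> [y c x z|x c y z]; first exact: ell2_dot_linearl.
by rewrite ell2_dotC ell2_dot_linearl rmorphD rmorphM (ell2_dotC x y)
   (ell2_dotC x z).
Qed.

Lemma ell2_dotxx x :
  ell2_dot x x = (limn (series (fun k => normc (x k) ^+ 2)))%:C.
Proof.
rewrite /ell2_dot /csum.
rewrite (_ : (fun k => complex.Re _) = (fun k => normc (x k) ^+ 2)); last first.
  by apply/funext => k; rewrite sqr_normcE; case: (x k) => p q /=; ring.
rewrite (_ : (fun k => complex.Im _) = (fun=> 0)); last first.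
  by apply/funext => k; case: (x k) => p q /=; ring.
rewrite [X in _ +i* limn X](_ : _ = cst 0) ?lim_cst//.
by apply/funext => n; rewrite /series/= big1.
Qed.

Lemma ell2_dot_gt0 x : x != 0 -> 0 < ell2_dot x x.
Proof.
move=> x0; rewrite ell2_dotxx ltcR.
have [k xk0] : exists k, x k != 0.
  apply: contrapT => /forallNP h; move/eqP: x0; apply.
  apply/val_inj/funext => k.
  by have /negP := h k; rewrite negbK => /eqP.
apply: (@lt_le_trans _ _ (series (fun k => normc (x k) ^+ 2) k.+1)).
  rewrite /series/= big_nat_recr//= ltr_wpDl//.
    by apply: sumr_ge0 => i _; rewrite sqr_ge0.
  rewrite exprn_gt0// lt_neqAle normc_ge0 andbT eq_sym.
  by apply: contra xk0 => /eqP/eq0_normc ->.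
apply: nondecreasing_cvgn_le; last exact: ell2P.
by apply: nondecreasing_series => i _ _; rewrite sqr_ge0.
Qed.

End Ell2Dot.

HB.instance Definition _ (R : realType) :=
  bilinear_isBilinear.Build R[i] (ell2 R) (ell2 R) R[i] *%R (Num.conj \; *%R)
    (@ell2_dot R) (@ell2_dot_bilinear R).
HB.instance Definition _ (R : realType) :=
  isHermitianSesquilinear.Build R[i] (ell2 R) false Num.conj (@ell2_dot R)
    (@ell2_dot_herm R).
HB.instance Definition _ (R : realType) :=
  isDotProduct.Build R[i] (ell2 R) (@ell2_dot R) (@ell2_dot_gt0 R).

Lemma ell2_hnormE (R : realType) (x : ell2 R) :
  hnorm (@ell2_dot R) x = Num.sqrt (limn (series (fun k => normc (x k) ^+ 2))).
Proof. by congr Num.sqrt; exact: (congr1 (@complex.Re R) (ell2_dotxx x)). Qed.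

Record linfty (R : realType) := Linfty {
  linfty_val :> nat -> R[i];
  linfty_bounded : bounded_fun (fun k => normc (linfty_val k)) }.

Section WeightedShift.
Context {R : realType}.
Implicit Types (a : linfty R) (x : ell2 R).

Definition linfty_norm a : R := sup (range (fun k => normc (a k))).

Definition wshift_fun (a x : nat -> R[i]) : nat -> R[i] :=
  fun k => if k is k'.+1 then a k' * x k' else 0.

Lemma linfty_ubound a : exists2 M : R, 0 < M & forall k, normc (a k) <= M.
Proof.
have /bounded_fun_has_ubound[M aM] := linfty_bounded a.
exists (`|M| + 1); first by rewrite ltr_wpDl.
move=> k; rewrite (@le_trans _ _ M)//; first by apply: aM; exists k.
by rewrite (le_trans (ler_norm M))// lerDl.
Qed.

Lemma series_wshift (a x : nat -> R[i]) n :
  series (fun k => normc (wshift_fun a x k) ^+ 2) n.+1 =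
  series (fun k => normc (a k) ^+ 2 * normc (x k) ^+ 2) n.
Proof.
rewrite /series/= big_nat_recl//.
rewrite (_ : wshift_fun a x 0 = 0)// normc0 expr0n add0r.
by apply: eq_bigr => i _; rewrite -exprMn -normcM.
Qed.

Lemma wshift_subproof a x : wshift_fun a x \in ell2_pred.
Proof.
apply/asboolP; have [M M0 aM] := linfty_ubound a.
pose g k := normc (a k) ^+ 2 * normc (x k) ^+ 2.
suff hg : cvgn (series g).
  apply: (cvgP (limn (series g))); rewrite -cvg_shiftS.
  rewrite (_ : (fun n => series _ n.+1) = series g)//.
  by apply/funext => n; exact: series_wshift.
apply: (@series_le_cvg _ _ (fun k => M ^+ 2 * normc (x k) ^+ 2)).
- by move=> n; apply: mulr_ge0; rewrite sqr_ge0.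
- by move=> n; apply: mulr_ge0; rewrite sqr_ge0.
- move=> n; rewrite ler_wpM2r ?sqr_ge0//.
  by rewrite ler_sqr ?nnegrE ?normc_ge0 // ltW.
- by apply: is_cvg_seriesZ; exact: ell2P.
Qed.

Definition wshift a x : ell2 R := Ell2 (wshift_subproof a x).

Lemma wshift_is_linear a : linear (wshift a).
Proof.
move=> c x y; apply/val_inj/funext => -[|k].
  by rewrite -[RHS]/(c * 0 + 0) mulr0 addr0.
rewrite -[LHS]/(a k * (c * x k + y k)) -[RHS]/(c * (a k * x k) + a k * y k).
by rewrite mulrDr mulrCA.
Qed.

HB.instance Definition _ a :=
  GRing.isLinear.Build R[i] (ell2 R) (ell2 R) *:%R (wshift a)
    (wshift_is_linear a).

Lemma wshift_bounded a : bounded_operator (@ell2_dot R) (wshift a).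
Proof.
have [M M0 aM] := linfty_ubound a; exists M => x.
rewrite !ell2_hnormE -[M in leRHS]gtr0_norm// -sqrtr_sqr -sqrtrM ?sqr_ge0//.
rewrite ler_wsqrtr//; apply: limr_le; first exact: ell2P (wshift a x).
have x_ge0 k : 0 <= normc (x k) ^+ 2 by rewrite sqr_ge0.
apply: nearW => -[|n].
  rewrite {1}/series/= big_geq// mulr_ge0 ?sqr_ge0//.
  apply: limr_ge; first exact: ell2P.
  by apply: nearW => n; rewrite /series/= sumr_ge0.
rewrite series_wshift (@le_trans _ _ (M ^+ 2 * series (fun k => normc (x k) ^+ 2) n))//.
  rewrite /series/= mulr_sumr; apply: ler_sum => k _.
  by rewrite ler_wpM2r// ler_sqr ?nnegrE ?normc_ge0// ltW.
apply: ler_wpM2l; first exact: sqr_ge0.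
apply: nondecreasing_cvgn_le; last exact: ell2P.
by apply: nondecreasing_series.
Qed.

Definition linfty_wnorm a : R := numerical_radius (@ell2_dot R) (wshift a).

(* The quantity M(b); its inner sum runs over b_(j+1), ..., b_(j+n) in 1-based
   indexing, and the junk term at n = 0 does not affect the limit. *)
Definition max_mean (b : nat -> R) : R :=
  limn (fun n => sup (range (fun j => n%:R^-1 * \sum_(k < n) b (k + j)%N))).

End WeightedShift.

(* Main.v *)
Require Import Defs.
From HB Require Import structures.
From mathcomp Require Import all_boot all_order all_algebra.
From mathcomp Require Import all_classical all_reals all_analysis.
From mathcomp Require Import complex.
From mathcomp Require Import ring lra.
Import Order.TTheory GRing.Theory Num.Theory.
Import numFieldNormedType.Exports.
Import ComplexField.Normc.
Local Open Scope ring_scope.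

(** Write b_k = |a_k|, and for each n let s_n be the supremum over j of the sum
of the n consecutive terms b_j, ..., b_(j+n-1).  Since s_(m+n) <= s_m + s_n,
Fekete's lemma ([fekete], [max_mean_cvg]) shows that s_n / n converges to M(b);
this convergence is what makes M(b) usable as a number, both to extract a good
window length ([max_mean_lt]) and to bound M(b) from above ([max_mean_le]).

- M(b) <= w(T_a): on the window j, ..., j+n put a unit vector x with entries of
  equal modulus 1 / sqrt (n+1), whose phases are chosen so that every term of
  <T_a x, x> is nonnegative.  Then <T_a x, x> is the sum of the n terms of b from
  j on, divided by n+1 ([numerical_value_window]), and n -> oo gives the claim
  ([max_mean_le_wnorm]).

- w(T_a) <= sup b: term by term, |a_k x_k x_(k+1)| is at most
  sup b (|x_k|^2 + |x_(k+1)|^2) / 2 ([numerical_value_le]).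

- r(T_a) <= M(b): let |z| > r > M(b).  For some n, all means of b over n
  consecutive indices are at most r, so by the inequality between arithmetic and
  geometric means all products of n consecutive b_k are at most r^n.  Hence the
  bounded weights V_k = sum_(m < n) b_k ... b_(k+m-1) / r^m, which are at least 1,
  satisfy b_k V_(k+1) <= r V_k ([shift_weight]): in the norm of the sequence
  (V_k |x_k|), equivalent to the original one, T_a has norm at most r.  The
  equation T_a x - z x = y has a unique solution among all sequences, given by
  recursion on the index.  In the weighted norm this recursion is a contraction
  with ratio r / |z| < 1 perturbed by y, so that the solution is square summable
  with norm at most a constant times that of y ([resolvent_fun_bounded]), and z
  is not in the spectrum ([spectrum_le_max_mean]). *)

(** * Maximal means of bounded sequences *)

Section Means.
Local Open Scope classical_set_scope.

(** Fekete's lemma: cutting n into blocks of a fixed length N gives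
s n <= (n %/ N) * s N + C, with C independent of n, so no mean at an arbitrary N
lies below the upper limit of the means; the limit is the infimum of the means. *)
Lemma fekete (R : realType) (s : nat -> R) :
  (forall m n, s (m + n)%N <= s m + s n) -> (forall n, 0 <= s n) ->
  cvgn (fun n => n%:R^-1 * s n).
Proof.
move=> s_sub s_ge0.
pose E := range (fun n => n.+1%:R^-1 * s n.+1).
have mean_ge0 n : 0 <= n%:R^-1 * s n by rewrite mulr_ge0// invr_ge0.
have E_lb : lbound E 0 by move=> _ [n _ <-].
apply/cvg_ex; exists (inf E); apply/cvgrPdist_le => e e0.
have [||_ [N' _ <-]] := @inf_adherent _ E (e / 2).
- by rewrite divr_gt0.
- by split; [exists (1%:R^-1 * s 1%N), 0%N | exists 0].
set N := N'.+1 => N_near.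
(* s 0 need not vanish, hence the extra term. *)
have s_mul q : s (q * N)%N <= q%:R * s N + s 0%N.
  elim: q => [|q IH]; first by rewrite mul0n mul0r add0r.
  by rewrite mulSn (le_trans (s_sub _ _))// mulrS mulrDl mul1r -addrA lerD2l.
pose C := s 0%N + \sum_(i < N) s i.
have C_ge0 : 0 <= C by rewrite addr_ge0// sumr_ge0.
near=> n.
have n_gt0 : (0 < n)%N by near: n; exact: nbhs_infty_ge.
have n0 : 0 < n%:R :> R by rewrite ltr0n.
have nC : C / (e / 2) <= n%:R by near: n; exact: nbhs_infty_ger.
have inf_n : inf E <= n%:R^-1 * s n.
  by apply: ge_inf; [exists 0 | exists n.-1; rewrite ?prednK].
have s_n : s n <= (n %/ N)%:R * s N + C.
  rewrite {1}(divn_eq n N) (le_trans (s_sub _ _))// /C addrA lerD//.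
  have nN : (n %% N < N)%N by rewrite ltn_mod.
  by rewrite (bigD1 (Ordinal nN))//= lerDl sumr_ge0.
have q_n : (n %/ N)%:R * s N <= n%:R * (N%:R^-1 * s N).
  rewrite mulrA ler_wpM2r// ler_pdivlMr// -natrM ler_nat leq_trunc_div//.
have mean_n : n%:R^-1 * s n <= N%:R^-1 * s N + e / 2.
  rewrite mulrC ler_pdivrMr// mulrDl (le_trans s_n)// lerD//.
    by rewrite [leRHS]mulrC.
  by rewrite mulrC -ler_pdivrMr// divr_gt0.
rewrite ler0_norm ?subr_le0// opprB lerBlDl (le_trans mean_n)//.
by rewrite (le_trans (lerD (ltW N_near) (lexx _)))// -addrA -splitr addrC.
Unshelve. all: by end_near. Qed.

Section BoundedSequence.
Variables (R : realType) (b : nat -> R) (A : R).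
Hypotheses (b_ge0 : forall k, 0 <= b k) (b_le : forall k, b k <= A).

Let window n j := \sum_(k < n) b (k + j)%N.

Let window_ge0 n j : 0 <= window n j.
Proof. exact: sumr_ge0. Qed.

Let mean_has_ubound n : has_ubound (range (fun j => n%:R^-1 * window n j)).
Proof.
exists (n%:R^-1 * (A *+ n)) => _ [j _ <-]; rewrite ler_wpM2l ?invr_ge0//.
by rewrite -[in leRHS](card_ord n) -sumr_const ler_sum.
Qed.

Let window_le n j :
  window n j <= n%:R * sup (range (fun i => n%:R^-1 * window n i)).
Proof.
case: n => [|n]; first by rewrite /window big_ord0 mul0r.
rewrite mulrC -ler_pdivrMr// mulrC.
by apply: (ub_le_sup (mean_has_ubound n.+1)); exists j.
Qed.

(** The limit that defines [max_mean] exists, because the suprema of the window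
sums are subadditive in the length of the window. *)
Lemma max_mean_cvg :
  (fun n => sup (range (fun j => n%:R^-1 * \sum_(k < n) b (k + j)%N))) @ \oo
    --> max_mean b.
Proof.
apply/cvg_ex; pose s n := n%:R * sup (range (fun j => n%:R^-1 * window n j)).
have -> : (fun n => sup (range (fun j => n%:R^-1 * window n j))) =
          (fun n => n%:R^-1 * s n).
  apply/funext => -[|n]; last by rewrite /s mulKf.
  have -> : range (fun j => 0%:R^-1 * window 0 j) = [set 0].
    apply/seteqP; split => [_ [j _ <-]|_ ->]; [|exists 0%N];
      by rewrite /= ?invr0 ?mul0r.
  by rewrite sup1 invr0 mul0r.
apply/cvg_ex/fekete => [m n|n]; last first.
  by rewrite (le_trans _ (window_le n 0))// window_ge0.
have [->|mn0] := eqVneq (m + n)%N 0%N; first by rewrite /s mul0r addr_ge0//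
  (le_trans _ (window_le _ 0))// window_ge0.
rewrite {1}/s mulrC -ler_pdivlMr ?ltr0n ?lt0n//.
apply: ge_sup; first by exists ((m + n)%:R^-1 * window (m + n) 0), 0%N.
move=> _ [j _ <-]; rewrite mulrC ler_pM2r ?invr_gt0 ?ltr0n ?lt0n//.
rewrite {1}/window big_split_ord/= lerD ?window_le//.
rewrite (eq_bigr (fun k : 'I_n => b (k + (m + j))%N)) ?window_le// => k _.
by congr b; rewrite addnCA addnA.
Qed.

Lemma max_mean_ge0 : 0 <= max_mean b.
Proof.
rewrite -(cvg_lim _ max_mean_cvg)//; apply: limr_ge.
  by apply: cvgP; exact: max_mean_cvg.
apply: nearW => n; apply: le_trans (ub_le_sup (mean_has_ubound n) _); last first.
  by exists 0%N.
by rewrite mulr_ge0 ?invr_ge0.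
Qed.

Lemma max_mean_lt r : max_mean b < r ->
  exists2 n, (0 < n)%N & forall j, \sum_(k < n) b (k + j)%N <= n%:R * r.
Proof.
move=> Mr; have := cvgr_lt _ max_mean_cvg _ Mr.
case=> N _ hN; exists N.+1 => // j.
by rewrite (le_trans (window_le _ j))// ler_wpM2l// ltW// hN//=.
Qed.

(** The factor n.+1 in place of n accounts for the end effect of a test vector of
n.+1 entries, on which the shift contributes only n products; it is harmless in
the limit. *)
Lemma max_mean_le w :
  (forall n j, \sum_(k < n) b (k + j)%N <= n.+1%:R * w) -> max_mean b <= w.
Proof.
move=> hw.
have w0 : 0 <= w.
  by have := hw 0%N 0%N; rewrite big_ord0 mul1r.
apply/ler_addgt0Pr => e e0.
rewrite -(cvg_lim _ max_mean_cvg)//; apply: limr_le.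
  by apply: cvgP; exact: max_mean_cvg.
near=> n.
have n_gt0 : (0 < n)%N by near: n; exact: nbhs_infty_ge.
have nw : w / e <= n%:R by near: n; exact: nbhs_infty_ger.
apply: ge_sup; first by exists (n%:R^-1 * window n 0), 0%N.
move=> _ [j _ <-]; rewrite mulrC ler_pdivrMr ?ltr0n// (le_trans (hw n j))//.
move: nw; rewrite ler_pdivrMr// -natr1; lra.
Unshelve. all: by end_near. Qed.

(** With p_m k the product of the m numbers b k / r, b (k + 1) / r, ..., the
weights V k = p_0 k + ... + p_(n-1) k satisfy
b k * V k.+1 = r * (p_1 k + ... + p_n k), so the claim amounts to
p_n k <= 1 = p_0 k, which is the inequality between the geometric and the
arithmetic means of a window. *)
Lemma shift_weight n r : (0 < n)%N -> 0 < r ->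
  (forall j, \sum_(k < n) b (k + j)%N <= n%:R * r) ->
  exists V : nat -> R, exists B : R,
  [/\ forall k, 1 <= V k, forall k, V k <= B & forall k, b k * V k.+1 <= r * V k].
Proof.
move=> n0 r0 hn.
pose p m k := \prod_(i < m) (b (k + i)%N / r).
have p_ge0 m k : 0 <= p m k by apply: prodr_ge0 => i _; rewrite divr_ge0// ltW.
have p_rec m k : b k * p m k.+1 = r * p m.+1 k.
  rewrite /p big_ord_recl/= addn0 mulrA [r * _]mulrCA divff ?gt_eqF// mulr1.
  by congr (_ * _); apply: eq_bigr => i _; rewrite addSnnS.
have p_n k : p n k <= 1.
  have := @leif_AGM R 'I_n predT (fun i => b (k + i)%N / r).
  case=> [i _|]; first by rewrite divr_ge0// ltW.
  move=> + _; rewrite /p => /le_trans; apply.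
  rewrite card_ord exprn_ile1//.
    by rewrite mulr_ge0 ?invr_ge0// sumr_ge0// => i _; rewrite divr_ge0// ltW.
  rewrite -mulr_suml ler_pdivrMr ?ltr0n// ler_pdivrMr// mul1r.
  by under eq_bigr do rewrite addnC; exact: hn.
exists (fun k => \sum_(m < n) p m k), (\sum_(m < n) (A / r) ^+ m); split => k.
- by rewrite (bigD1 (Ordinal n0))//= {1}/p big_ord0 lerDl sumr_ge0.
- apply: ler_sum => m _; rewrite -[in leRHS](card_ord m) -prodr_const.
  by apply: ler_prod => i _; rewrite divr_ge0 ?(ltW r0)//= ler_pM2r ?invr_gt0.
- rewrite !mulr_sumr (eq_bigr (fun m : 'I_n => r * p m.+1 k)) => [|m _];
    last exact: p_rec.
  rewrite -!mulr_sumr ler_pM2l//.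
  rewrite -(lerD2l (p 0%N k)) -(big_ord_recl n (fun m => p m k)).
  rewrite big_ord_recr/= addrC lerD2r (le_trans (p_n k))//.
  by rewrite /p big_ord0.
Qed.

End BoundedSequence.

End Means.

(** * Norms and inner products of square-summable sequences *)

Section SquareSummable.
Local Open Scope classical_set_scope.
Context {R : realType}.
Implicit Types (x : nat -> R[i]) (y : ell2 R) (a : linfty R).

Lemma sum_sqr_le_hnorm y n :
  \sum_(k < n) normc (y k) ^+ 2 <= hnorm (@ell2_dot R) y ^+ 2.
Proof.
have nd : nondecreasing_seq (series (fun k => normc (y k) ^+ 2)).
  by apply: nondecreasing_series => i _ _; rewrite sqr_ge0.
have le_lim m := nondecreasing_cvgn_le nd (@ell2P R y) m.
rewrite ell2_hnormE sqr_sqrtr; last first.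
  by have := le_lim 0%N; rewrite /series/= big_geq.
by have := le_lim n; rewrite /series/= big_mkord.
Qed.

Lemma square_summable_bounded x C :
  (forall n, \sum_(k < n) normc (x k) ^+ 2 <= C) -> x \in ell2_pred.
Proof.
move=> hC; apply/asboolP; apply: nondecreasing_is_cvgn.
  by apply: nondecreasing_series => i _ _; rewrite sqr_ge0.
by exists C => _ [n _ <-]; rewrite /series/= big_mkord.
Qed.

Lemma hnorm_le y C : 0 <= C ->
  (forall n, \sum_(k < n) normc (y k) ^+ 2 <= C ^+ 2) -> hnorm (@ell2_dot R) y <= C.
Proof.
move=> C0 hC; rewrite ell2_hnormE -[C]ger0_norm// -sqrtr_sqr ler_wsqrtr//.
apply: limr_le; first exact: ell2P.
by apply: nearW => n; rewrite /series/= big_mkord.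
Qed.

Lemma cvg_series_finite_support (f : nat -> R) N :
  (forall k, (N <= k)%N -> f k = 0) -> series f @ \oo --> \sum_(k < N) f k.
Proof.
move=> f0; apply: cvg_near_cst; exists N => // n /= Nn.
rewrite /series/= -(subnKC Nn) big_mkord big_split_ord/= [X in _ + X]big1 ?addr0//.
by move=> k _; rewrite f0// leq_addr.
Qed.

Lemma normc_sum (u : nat -> R[i]) n :
  normc (\sum_(k < n) u k) <= \sum_(k < n) normc (u k).
Proof.
elim: n => [|n IH]; first by rewrite !big_ord0 normc0.
by rewrite !big_ord_recr/= (le_trans (le_normcD _ _))// lerD2r.
Qed.

Lemma normc_csum_le (u : nat -> R[i]) B :
  cvgn (series (fun k => complex.Re (u k))) ->
  cvgn (series (fun k => complex.Im (u k))) ->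
  (forall n, \sum_(k < n) normc (u k) <= B) -> normc (csum u) <= B.
Proof.
move=> cvgRe cvgIm hB.
have B0 : 0 <= B by have := hB 0%N; rewrite big_ord0.
rewrite -[B]ger0_norm// -sqrtr_sqr /csum /= ler_wsqrtr//.
have cvgS : (series (fun k => complex.Re (u k)) \* series (fun k => complex.Re (u k)) +
    series (fun k => complex.Im (u k)) \* series (fun k => complex.Im (u k))) @ \oo -->
    limn (series (fun k => complex.Re (u k))) * limn (series (fun k => complex.Re (u k))) +
    limn (series (fun k => complex.Im (u k))) * limn (series (fun k => complex.Im (u k))).
  by apply: cvgD; apply: cvgM.
rewrite !expr2 -(cvg_lim _ cvgS)//; apply: limr_le; first by apply: cvgP; exact: cvgS.
apply: nearW => n /=; rewrite !fctE -!expr2 /series/= !big_mkord.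
rewrite -(raddf_sum (@complex.Re R)) -(raddf_sum (@complex.Im R)) -sqr_normcE.
rewrite lerXn2r ?nnegrE ?normc_ge0//.
exact: le_trans (normc_sum _ _) (hB n).
Qed.

End SquareSummable.

(** * The numerical radius of a weighted shift *)

Section NumericalRadius.
Local Open Scope classical_set_scope.
Local Open Scope complex_scope.
Context {R : realType}.
Implicit Types (x : ell2 R) (a : linfty R).

Lemma normc_conj (z : R[i]) : normc (Num.conj z) = normc z.
Proof. by case: z => p q /=; rewrite sqrrN. Qed.

Lemma normc_le_linfty_norm a k : normc (a k) <= linfty_norm a.
Proof.
have [M _ aM] := linfty_ubound a.
apply: ub_le_sup; last by exists k.
by exists M => _ [j _ <-].
Qed.

Lemma linfty_norm_ge0 a : 0 <= linfty_norm a.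
Proof. exact: le_trans (normc_ge0 _) (normc_le_linfty_norm a 0). Qed.

(** The inner product is at most half the weight bound times the sum of the squared
norms of x and of x without its first entry. *)
Lemma numerical_value_le a x : hnorm (@ell2_dot R) x = 1 ->
  normc (ell2_dot (wshift a x) x) <= linfty_norm a.
Proof.
move=> x1; apply: normc_csum_le; [exact: ell2_Re_cvg|exact: ell2_Im_cvg|].
have A0 := linfty_norm_ge0 a.
case=> [|n]; first by rewrite big_ord0.
rewrite big_ord_recl/= mul0r normc0 add0r.
pose A := linfty_norm a.
apply: (@le_trans _ _ (\sum_(k < n) (A / 2 * normc (x k) ^+ 2 +
                                     A / 2 * normc (x k.+1) ^+ 2))).
  apply: ler_sum => k _; rewrite normcM normc_conj normcM -/A.
  rewrite -mulrDr -!mulrA.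
  apply: ler_pM; rewrite ?mulr_ge0 ?normc_ge0 ?normc_le_linfty_norm//.
  by have := sqr_ge0 (normc (x k) - normc (x k.+1)); rewrite sqrrB; lra.
rewrite big_split/= -!mulr_sumr.
have sum_x m : \sum_(k < m) normc (x k) ^+ 2 <= 1.
  by have := sum_sqr_le_hnorm x m; rewrite x1 expr1n.
have sum_x' : \sum_(k < n) normc (x k.+1) ^+ 2 <= 1.
  by rewrite (le_trans _ (sum_x n.+1))// big_ord_recl/= lerDr sqr_ge0.
have A2 : 0 <= A / 2 by rewrite divr_ge0.
apply: (le_trans (lerD (ler_wpM2l A2 (sum_x n)) (ler_wpM2l A2 sum_x'))).
by rewrite !mulr1 -splitr.
Qed.

Lemma sum_window (V : nmodType) (f : nat -> V) j n :
  \sum_(k < j + n) (if (j <= k)%N then f k else 0) = \sum_(k < n) f (k + j)%N.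
Proof.
rewrite big_split_ord/= [X in X + _]big1 ?add0r; last first.
  by move=> k _; rewrite leqNgt ltn_ord.
by apply: eq_bigr => k _; rewrite leq_addr addnC.
Qed.

Lemma conjM (z w : R[i]) : Num.conj (z * w) = Num.conj z * Num.conj w.
Proof. exact: rmorphM. Qed.

Lemma conj_real_complex (r : R) : Num.conj r%:C = r%:C.
Proof. exact: conjc_real. Qed.

Definition phase (z : R[i]) : R[i] := if z == 0 then 1 else z * (normc z)^-1%:C.

Lemma normc_phase z : normc (phase z) = 1.
Proof.
rewrite /phase; case: eqVneq => [_|z0]; first exact: normc1.
have z1 : normc z != 0 by apply: contra z0 => /eqP/eq0_normc ->.
rewrite normcM /= expr0n addr0 sqrtr_sqr ger0_norm ?invr_ge0 ?normc_ge0//.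
by rewrite divff.
Qed.

Lemma mul_conj_normc (z : R[i]) : z * z^* = (normc z ^+ 2)%:C.
Proof. by rewrite sqr_normcE; case: z => p q; simpc; congr (_ +i* _); ring. Qed.

Lemma mul_conj_phase z : z * (phase z)^* = (normc z)%:C.
Proof.
rewrite /phase; case: eqVneq => [->|z0].
  by rewrite mul0r normc0.
have z1 : normc z != 0 by apply: contra z0 => /eqP/eq0_normc ->.
rewrite conjM mulrA mul_conj_normc conj_real_complex -rmorphM/=.
by rewrite expr2 mulfK.
Qed.

(** The phases that make all products a_k x_k (x_(k+1))^* nonnegative: each one
turns the previous one by the argument of the weight between them. *)
Fixpoint aligned (a : nat -> R[i]) k : R[i] :=
  if k is k'.+1 then phase (a k') * aligned a k' else 1.

Lemma normc_aligned a k : normc (aligned a k) = 1.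
Proof.
elim: k => [|k IH]; first exact: normc1.
by rewrite [aligned _ _]/= normcM normc_phase IH mulr1.
Qed.

Lemma aligned_product a k :
  a k * aligned a k * (aligned a k.+1)^* = (normc (a k))%:C.
Proof.
rewrite /= conjM mulrACA mul_conj_phase mul_conj_normc normc_aligned.
by rewrite expr1n mulr1.
Qed.

Definition window_fun (a : nat -> R[i]) j n k : R[i] :=
  if (j <= k < j + n.+1)%N then (Num.sqrt n.+1%:R)^-1%:C * aligned a k else 0.

Lemma sqr_normc_window_fun a j n k : normc (window_fun a j n k) ^+ 2 =
  if (j <= k < j + n.+1)%N then n.+1%:R^-1 else 0.
Proof.
rewrite /window_fun; case: ifP => _; last by rewrite normc0 expr0n.
rewrite normcM normc_aligned mulr1 /= expr0n addr0 sqrtr_sqr.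
by rewrite real_normK ?num_real// exprVn sqr_sqrtr.
Qed.

Lemma cvg_window_fun a j n :
  series (fun k => normc (window_fun a j n k) ^+ 2) @ \oo --> (1 : R).
Proof.
have -> : 1 = \sum_(k < j + n.+1) normc (window_fun a j n k) ^+ 2.
  transitivity (\sum_(k < j + n.+1) if (j <= k)%N then n.+1%:R^-1 else 0 : R).
    by rewrite (sum_window _ (fun=> n.+1%:R^-1)) sumr_const card_ord
      -[_ *+ _]mulr_natr mulVf.
  by apply: eq_bigr => k _; rewrite sqr_normc_window_fun ltn_ord andbT.
apply: cvg_series_finite_support => k kN.
by rewrite sqr_normc_window_fun ltnNge kN andbF.
Qed.

Lemma window_fun_subproof a j n : window_fun a j n \in ell2_pred.
Proof. by apply/asboolP; apply: cvgP; exact: cvg_window_fun. Qed.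

(** The test vector for the numerical radius: n.+1 consecutive entries of equal
modulus, starting at index j, with aligned phases. *)
Definition window_vector a j n : ell2 R := Ell2 (window_fun_subproof a j n).

Lemma hnorm_window_vector a j n : hnorm (@ell2_dot R) (window_vector a j n) = 1.
Proof. by rewrite ell2_hnormE (cvg_lim _ (cvg_window_fun a j n))// sqrtr1. Qed.

(** A product of two neighbouring entries is nonzero only if both indices lie in
the window, which leaves n products out of n.+1 entries. *)
Lemma numerical_value_window a j n :
  let x := window_vector a j n in
  complex.Re (ell2_dot (wshift a x) x) = (\sum_(k < n) normc (a (k + j)%N)) / n.+1%:R.
Proof.
rewrite /ell2_dot /csum /=.
have term k : complex.Re (wshift_fun a (window_fun a j n) k.+1 *
                          (window_fun a j n k.+1)^*) =
    if (j <= k < j + n)%N then normc (a k) / n.+1%:R else 0.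
  rewrite /= /window_fun addnS !ltnS.
  have [jk|kj]/= := leqP j k; last by rewrite mulr0 mul0r.
  have [kn|nk] := ltnP k (j + n); last first.
    by rewrite andbF rmorph0 mulr0.
  rewrite (leqW jk) (ltnW kn)/= conjM conj_real_complex.
  rewrite [a k * _]mulrCA mulrACA.
  rewrite aligned_product -!rmorphM/= -expr2 exprVn sqr_sqrtr// mulrC//.
rewrite (cvg_lim _ (@cvg_series_finite_support _ _ (j + n).+1 _))//.
  rewrite big_ord_recl/= mul0r add0r.
  under eq_bigr do rewrite term.
  rewrite mulr_suml -(sum_window _ (fun k => normc (a k) / n.+1%:R)).
  apply: eq_bigr => k _.
  by rewrite ltn_ord andbT.
case=> // k kN; rewrite term ifF//; apply/negP => /andP[_].
by rewrite ltnNge -ltnS kN.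
Qed.

Lemma linfty_wnorm_ubound a :
  ubound [set normc (ell2_dot (wshift a x) x) | x in [set x | hnorm (@ell2_dot R) x = 1]]
    (linfty_norm a).
Proof. by move=> _ [x x1 <-]; exact: numerical_value_le. Qed.

Lemma linfty_wnorm_le_norm a : linfty_wnorm a <= linfty_norm a.
Proof.
apply: ge_sup; last exact: linfty_wnorm_ubound.
pose x := window_vector a 0 0.
by exists (normc (ell2_dot (wshift a x) x)), x => //; exact: hnorm_window_vector.
Qed.

Lemma max_mean_le_wnorm a : max_mean (fun k => normc (a k)) <= linfty_wnorm a.
Proof.
apply: max_mean_le; [exact: (fun k => normc_ge0 (a k))|exact: normc_le_linfty_norm|].
move=> n j; rewrite mulrC -ler_pdivrMr// -numerical_value_window.
set x := window_vector a j n; apply: (@le_trans _ _ (normc (ell2_dot (wshift a x) x))).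
  case: (ell2_dot _ _) => p q /=.
  rewrite (le_trans (ler_norm p))// -sqrtr_sqr ler_wsqrtr// lerDl sqr_ge0//.
apply: ub_le_sup; first by exists (linfty_norm a); exact: linfty_wnorm_ubound.
by exists x => //; exact: hnorm_window_vector.
Qed.

End NumericalRadius.

(** * The resolvent of a weighted shift *)

(** Pointwise, (q u + h)^2 <= q u^2 + h^2 / (1 - q) by convexity of the square
(write h as (1 - q) times h / (1 - q)); summing absorbs q times the sum of the
squares of u into the left-hand side. *)
Lemma contraction_sum_sqr (R : realType) (u h : nat -> R) (q : R) :
  0 <= q < 1 -> (forall k, 0 <= u k) -> u 0%N <= h 0%N ->
  (forall k, u k.+1 <= q * u k + h k.+1) ->
  forall n, \sum_(k < n) u k ^+ 2 <= (\sum_(k < n) h k ^+ 2) / (1 - q) ^+ 2.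
Proof.
move=> /andP[q0 q1] u0 u_0 u_rec n.
have q'0 : 0 < 1 - q by rewrite subr_gt0.
case: n => [|n]; first by rewrite !big_ord0 mul0r.
rewrite expr2 invfM mulrA ler_pdivlMr// mulrBr mulr1 lerBlDr.
have u_sqr k : u k.+1 ^+ 2 <= q * u k ^+ 2 + h k.+1 ^+ 2 / (1 - q).
  apply: (@le_trans _ _ ((q * u k + h k.+1) ^+ 2)).
    by rewrite lerXn2r ?nnegrE// (le_trans (u0 k.+1)).
  rewrite -subr_ge0 (_ : _ - _ = q / (1 - q) * ((1 - q) * u k - h k.+1) ^+ 2).
    by rewrite mulr_ge0 ?sqr_ge0// divr_ge0// ltW.
  by field; rewrite gt_eqF.
apply: (@le_trans _ _ (q * (\sum_(k < n) u k ^+ 2) +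
                       (\sum_(k < n.+1) h k ^+ 2) / (1 - q))).
  rewrite !big_ord_recl/= mulrDl mulr_sumr mulr_suml addrCA -big_split/=.
  apply: lerD; last exact: ler_sum.
  rewrite ler_pdivlMr// (@le_trans _ _ (u 0%N ^+ 2))//.
    by rewrite ler_piMr ?sqr_ge0// gerBl.
  by rewrite lerXn2r ?nnegrE// (le_trans (u0 0%N)).
rewrite addrC lerD2l mulrC ler_wpM2r// big_ord_recr/= lerDl sqr_ge0//.
Qed.

Section Resolvent.
Local Open Scope classical_set_scope.
Context {R : realType}.
Implicit Types (x y : nat -> R[i]) (a : linfty R) (z : R[i]).

(** The only candidate for the solution x of T x - z x = y, solved for the entries
of x one after the other; it makes sense for every sequence y. *)
Fixpoint resolvent_fun (a : nat -> R[i]) z y k : R[i] :=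
  ((if k is k'.+1 then a k' * resolvent_fun a z y k' else 0) - y k) / z.

Lemma resolvent_funE a z y k :
  resolvent_fun a z y k = (wshift_fun a (resolvent_fun a z y) k - y k) / z.
Proof. by case: k. Qed.

Lemma resolvent_fun_linear a z c x y k :
  resolvent_fun a z (fun i => c * x i + y i) k =
  c * resolvent_fun a z x k + resolvent_fun a z y k.
Proof. by elim: k => [|k IH] /=; rewrite ?IH; ring. Qed.

Lemma resolvent_fun_solves a z y k : z != 0 ->
  wshift_fun a (resolvent_fun a z y) k - z * resolvent_fun a z y k = y k.
Proof. by move=> z0; rewrite [in z * _]resolvent_funE mulrCA divff//; ring. Qed.

Lemma resolvent_funK a z x k : z != 0 ->
  resolvent_fun a z (fun i => wshift_fun a x i - z * x i) k = x k.
Proof.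
by move=> z0; elim: k => [|k IH] /=; rewrite ?IH opprB addrC ?addr0 ?subrK
  ?subr0 mulrC mulKf.
Qed.

(** In the norm weighted by the V of [shift_weight], the recursion defining the
solution is a contraction of ratio q = r / |z|; the bounds 1 <= V <= B carry the
estimate back to the original norm. *)
Lemma resolvent_fun_bounded a z :
  max_mean (fun k => normc (a k)) < normc z ->
  exists2 C : R, 0 <= C & forall y n,
    \sum_(k < n) normc (resolvent_fun a z y k) ^+ 2 <=
    C ^+ 2 * \sum_(k < n) normc (y k) ^+ 2.
Proof.
set b := fun k => normc (a k); set t := normc z => Mt.
have b_ge0 k : 0 <= b k by exact: normc_ge0.
have b_le k : b k <= linfty_norm a by exact: normc_le_linfty_norm.
have M_ge0 : 0 <= max_mean b by exact: max_mean_ge0 b_ge0 b_le.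
have [t0 /andP[Mr rt]] : 0 < t /\ max_mean b < (max_mean b + t) / 2 < t.
  by split; [|apply/andP; split]; lra.
(* Any r strictly between the maximal mean and |z| would do. *)
set r := (max_mean b + t) / 2 in Mr rt.
have r0 : 0 < r by exact: le_lt_trans Mr.
have [N N0 hN] := max_mean_lt _ _ _ b_ge0 b_le _ Mr.
have [V [B [V_ge1 V_le bV]]] := shift_weight _ _ _ b_ge0 b_le _ _ N0 r0 hN.
have V_ge0 k : 0 <= V k by exact: le_trans (V_ge1 k).
have B_ge0 : 0 <= B by exact: le_trans (V_le 0%N).
pose q := r / t.
have q01 : 0 <= q < 1.
  by rewrite divr_ge0 ?(ltW r0) ?(ltW t0)//= ltr_pdivrMr// mul1r.
have q'0 : 0 < 1 - q by rewrite subr_gt0; case/andP: q01.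
exists (B / t / (1 - q)) => [|y n]; first by rewrite !divr_ge0// ltW.
pose x := resolvent_fun a z y.
have x_rec k : normc (x k.+1) <= (b k * normc (x k) + normc (y k.+1)) / t.
  rewrite /x /= normcM normcV ler_wpM2r ?invr_ge0 ?(ltW t0)//.
  by rewrite (le_trans (le_normcD _ _))// normcN normcM.
apply: (@le_trans _ _ (\sum_(k < n) (V k * normc (x k)) ^+ 2)).
  apply: ler_sum => k _; rewrite lerXn2r ?nnegrE ?mulr_ge0 ?normc_ge0//.
  by rewrite ler_peMl ?normc_ge0.
have u_0 : V 0%N * normc (x 0%N) <= B / t * normc (y 0%N).
  rewrite /x /= sub0r normcM normcN normcV -/t mulrA mulrAC.
  by rewrite ler_wpM2r ?normc_ge0// ler_wpM2r ?invr_ge0 ?(ltW t0).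
have u_rec k : V k.+1 * normc (x k.+1) <=
    q * (V k * normc (x k)) + B / t * normc (y k.+1).
  rewrite (le_trans (ler_wpM2l (V_ge0 _) (x_rec k)))//.
  rewrite [leLHS]mulrA ler_pdivrMr// mulrDl mulrDr.
  have -> : q * (V k * normc (x k)) * t = r * V k * normc (x k).
    by rewrite /q; field; rewrite gt_eqF.
  have -> : B / t * normc (y k.+1) * t = B * normc (y k.+1).
    by field; rewrite gt_eqF.
  rewrite lerD//; last by rewrite ler_wpM2r ?normc_ge0.
  by rewrite mulrA [V _ * _]mulrC ler_wpM2r ?normc_ge0.
have u_ge0 k : 0 <= V k * normc (x k) by rewrite mulr_ge0 ?normc_ge0.
have := contraction_sum_sqr _ _ (fun k => B / t * normc (y k)) _ q01 u_ge0 u_0 u_rec n.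
under [X in _ <= X / _ -> _]eq_bigr do rewrite exprMn.
by rewrite -mulr_sumr !expr_div_n mulrAC.
Qed.

Lemma max_mean_normc_ge0 a : 0 <= max_mean (fun k => normc (a k)).
Proof.
exact: max_mean_ge0 (fun k => normc_ge0 (a k)) (normc_le_linfty_norm a).
Qed.

Lemma spectrum_le_max_mean a z : spectrum (@ell2_dot R) (wshift a) z ->
  normc z <= max_mean (fun k => normc (a k)).
Proof.
move=> z_spec; rewrite leNgt; apply/negP => Mz; apply: z_spec.
have [C C0 hC] := resolvent_fun_bounded _ _ Mz.
have M_ge0 := max_mean_normc_ge0 a.
have z0 : z != 0.
  by apply/eqP => z0; move: (le_lt_trans M_ge0 Mz); rewrite z0 normc0 ltxx.
have hS (y : ell2 R) n : \sum_(k < n) normc (resolvent_fun a z y k) ^+ 2 <=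
    (C * hnorm (@ell2_dot R) y) ^+ 2.
  rewrite (le_trans (hC y n))// exprMn ler_wpM2l ?sqr_ge0//.
  exact: sum_sqr_le_hnorm.
pose S (y : ell2 R) := Ell2 (square_summable_bounded _ _ (hS y)).
have S_linear : linear S.
  by move=> c x y; apply/val_inj/funext => k; exact: resolvent_fun_linear.
pose SL := GRing.isLinear.Build R[i] (ell2 R) (ell2 R) *:%R S S_linear.
pose S' : {linear ell2 R -> ell2 R} := HB.pack S SL.
exists S'; split.
- exists C => y; apply: hnorm_le; last exact: hS.
  by rewrite mulr_ge0 ?sqrtr_ge0.
- by move=> x; apply/val_inj/funext => k; exact: resolvent_funK.
- by move=> x; apply/val_inj/funext => k; exact: resolvent_fun_solves.
Qed.

Lemma spectral_radius_le_max_mean a :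
  spectral_radius (@ell2_dot R) (wshift a) <= max_mean (fun k => normc (a k)).
Proof.
(* sup is 0 on the empty set, so this case needs only 0 <= max_mean. *)
rewrite /spectral_radius; set E := [set _ | _ in _].
have [->|E0] := eqVneq E set0.
  by rewrite sup0; exact: max_mean_normc_ge0.
apply: ge_sup; first exact/set0P.
by move=> _ [z z_spec <-]; exact: spectrum_le_max_mean.
Qed.

End Resolvent.

Theorem corollary2p2 (R : realType) (a : linfty R) :
  spectral_radius (@ell2_dot R) (wshift a) <= max_mean (fun k => normc (a k)) /\
  max_mean (fun k => normc (a k)) <= linfty_wnorm a /\
  linfty_wnorm a <= linfty_norm a.
Proof.
split; first exact: spectral_radius_le_max_mean.
by split; [exact: max_mean_le_wnorm | exact: linfty_wnorm_le_norm].
Qed.
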